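(* For every $n\ge 3$, the cycle $C_n$ of length $n$ is a $50\%$ max-tolerance graph.
   Context: Intervals are closed bounded intervals of the real line, and $|I|$ denotes the length of an interval $I$. A simple undirected graph $G=(V,E)$ is a $50\%$ max-tolerance graph if one can assign to each $u\in V$ an interval $I_u$ and a positive real tolerance $t_u$ with $t_u=|I_u|/2$ such that for distinct $u,v\in V$: $uv\in E$ if and only if $|I_u\cap I_v|\ge\max\{t_u,t_v\}$. *)

(* Defs.v *)
From HB Require Import structures.
From mathcomp Require Import all_boot all_order all_algebra.
From mathcomp Require Import all_classical all_reals all_analysis.

Set Implicit Arguments.
Unset Strict Implicit.
Unset Printing Implicit Defensive.

Import Order.TTheory GRing.Theory Num.Theory.

Record simple_graph := SimpleGraph {
  vertex :> finType;
  edge : rel vertex;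
  edge_sym : symmetric edge;
  edge_irr : irreflexive edge }.

(* [ordS i] is i + 1 modulo n. *)
Definition cycle_edge (n : nat) : rel 'I_n :=
  fun i j => (j == ordS i) || (i == ordS j).

Lemma cycle_edge_sym (n : nat) : symmetric (@cycle_edge n).
Proof. by move=> i j; rewrite /cycle_edge orbC. Qed.

Lemma cycle_edge_irr (n : nat) (hn : 3 <= n) : irreflexive (@cycle_edge n).
Proof.
move=> i; rewrite /cycle_edge orbb; apply/negbTE/eqP => /(congr1 val) /=.
have := ltn_ord i; rewrite leq_eqVlt => /orP[/eqP e|h].
  by rewrite e modnn => i0; move: hn; rewrite -e i0.
by rewrite modn_small// => /eqP; rewrite -[X in X == _]addn0 -addn1 eqn_add2l.
Qed.

Definition cycle_graph (n : nat) (hn : 3 <= n) : simple_graph :=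
  SimpleGraph (@cycle_edge_sym n) (cycle_edge_irr hn).

Local Open Scope classical_set_scope.
Local Open Scope ring_scope.

Definition closed_bounded_interval (R : realType) (A : set R) : Prop :=
  exists a b : R, a <= b /\ A = `[a, b]%classic.

(* Used only on bounded sets, where the measure is finite; an empty
   intersection has length 0. *)
Definition len (R : realType) (A : set R) : R :=
  fine (lebesgue_measure A).

Definition max_tolerance_graph_50 (R : realType) (G : simple_graph) : Prop :=
  exists (I : G -> set R) (t : G -> R),
    [/\ forall u, closed_bounded_interval (I u),
        forall u, 0 < t u,
        forall u, t u = len (I u) / 2 &
        forall u v, u != v ->
          (edge u v <-> Num.max (t u) (t v) <= len (I u `&` I v))].

(* Main.v *)
Require Import Defs.
From mathcomp Require Import all_boot all_order all_algebra.
From mathcomp Require Import all_classical all_reals all_analysis.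
From mathcomp Require Import zify lra.

(** Fold the cycle so that vertex [i] sits at level [k = min(i, n - 1 - i)], and
    give it an interval of length [4 * 2 ^ k]. Levels at distance at least 2 are
    then never adjacent, and vertices of consecutive levels are adjacent exactly
    when their intervals are nested. The interval of the first half of the cycle
    is [[-x, 4 * 2 ^ k - x]] and that of the second half is its mirror image, so
    two vertices of the same level overlap in length [2 * x]. The overhang [x]
    is 1 except at the top level: there it is [2 ^ k] when [n] is even, making
    the last two intervals adjacent, and [2 ^ (k + 1)] when [n] is odd, making
    the last interval symmetric and thus containing both intervals of the level
    below. *)

Set Implicit Arguments.
Unset Strict Implicit.
Unset Printing Implicit Defensive.

Import Order.TTheory GRing.Theory Num.Theory.

Section Representation.

Local Open Scope classical_set_scope.
Local Open Scope ring_scope.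

Lemma setI_itvcc (R : realType) (a b c d : R) :
  `[a, b]%classic `&` `[c, d]%classic = `[Num.max a c, Num.min b d]%classic.
Proof.
by apply/seteqP; split=> x /=; rewrite !in_itv/= ge_max le_min;
  [case=> /andP[-> ->] /andP[-> ->] | move=> /andP[/andP[-> ->] /andP[-> ->]]].
Qed.

Lemma len_itvcc (R : realType) (a b : R) :
  len `[a, b]%classic = Num.max 0 (b - a).
Proof.
rewrite /len lebesgue_measure_itv/= lte_fin.
by case: ltP => ab /=; [rewrite max_r | rewrite max_l]; lra.
Qed.

(** The nested minimum is [min b d - max a c], the signed length of the intersection. Its truncation
    at 0 in [len] is harmless because both half lengths are positive. *)
Lemma half_overlapP (R : realType) (a b c d : R) : a < b -> c < d ->
  Num.max (len `[a, b]%classic / 2) (len `[c, d]%classic / 2)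
    <= len (`[a, b]%classic `&` `[c, d]%classic) <->
  Num.max (b - a) (d - c)
    <= 2 * Num.min (Num.min (b - a) (d - c)) (Num.min (b - c) (d - a)).
Proof.
move=> ab cd; rewrite setI_itvcc !len_itvcc.
rewrite (@max_r _ _ 0 (b - a)) ?(@max_r _ _ 0 (d - c)); try lra.
have -> : Num.min (Num.min (b - a) (d - c)) (Num.min (b - c) (d - a)) =
    Num.min b d - Num.max a c.
  case: (leP a c) => ?; case: (leP b d) => ?; case: (leP (b - a)) => ?;
    case: (leP (b - c)) => ?; case: leP => ?; lra.
rewrite !ge_max !le_max.
by split=> [/andP[/orP[] ? /orP[] ?]|/andP[? ?]]; apply/andP; split;
  rewrite ?(orbC (_ <= 0)); try (apply/orP; left); lra.
Qed.

Lemma cycle_edgeP (n : nat) (i j : 'I_n) :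
  cycle_edge i j <-> [\/ j = i.+1 :> nat, i = j.+1 :> nat,
    i = 0%N :> nat /\ j = n.-1 :> nat | j = 0%N :> nat /\ i = n.-1 :> nat].
Proof.
have ordSE (k l : 'I_n) :
    (l == ordS k) = (l == k.+1 :> nat) || (k == n.-1 :> nat) && (l == 0%N :> nat).
  rewrite -val_eqE/=; have := ltn_ord k; have := ltn_ord l.
  have [->|kn] := eqVneq (k : nat) n.-1 => ln kn'.
    by rewrite prednK ?modnn; lia.
  by rewrite modn_small; lia.
rewrite /cycle_edge !ordSE; split; last by case; lia.
have [|] := eqVneq (j : nat) i.+1; first by constructor 1.
have [|] := eqVneq (i : nat) j.+1; first by constructor 2.
have [|] := eqVneq (i : nat) 0%N; first by move=> *; constructor 3; lia.
by move=> *; constructor 4; lia.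
Qed.

Variables (R : realType) (n : nat).

Definition level (i : nat) : nat := minn i (n.-1 - i).

(** [k.*2.+2] and [k.*2.+1] are the two cycle lengths whose top level is [k]. *)
Definition overhang (k : nat) : R :=
  if n == k.*2.+2 then 2 ^+ k else if n == k.*2.+1 then 2 * 2 ^+ k else 1.

Definition lo (i : nat) : R :=
  let k := level i in
  if (i.*2 < n)%N then - overhang k else overhang k - 4 * 2 ^+ k.

Definition hi (i : nat) : R :=
  let k := level i in
  if (i.*2 < n)%N then 4 * 2 ^+ k - overhang k else overhang k.

Lemma hi_sub_lo (i : nat) : hi i - lo i = 4 * 2 ^+ level i.
Proof. by rewrite /hi /lo; case: ifP => _; lra. Qed.

Lemma lo_lt_hi (i : nat) : lo i < hi i.
Proof. by rewrite -subr_gt0 hi_sub_lo mulr_gt0// exprn_gt0. Qed.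

Ltac decide_adjacency absurd :=
  do ?[case: ifP => ?]; try (exfalso; lia);
  (split; [by case=> ?; first [lia | do !split; lra] |]);
  case=> ? ? [*]; first
    [ exfalso; apply: absurd; lra
    | constructor 1; lia | constructor 2; lia
    | constructor 3; lia | constructor 4; lia ].

Lemma half_overlap_edge (i j : 'I_n) : (3 <= n)%N -> i != j ->
  (level i <= level j)%N ->
  cycle_edge i j <->
  Num.max (hi i - lo i) (hi j - lo j)
  <= 2 * Num.min (Num.min (hi i - lo i) (hi j - lo j))
    (Num.min (hi i - lo j) (hi j - lo i)).
Proof.
move=> n3 /eqP ij; have {}ij : i <> j :> nat by move=> /val_inj.
move=> kl; rewrite cycle_edgeP; have := ltn_ord i; have := ltn_ord j => jn iN.
have max_min (a b c d : R) : 0 < a -> 0 < b ->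
    Num.max a b <= 2 * Num.min (Num.min a b) (Num.min c d) <->
    [/\ a <= 2 * b, b <= 2 * a &
      [/\ a <= 2 * c, a <= 2 * d, b <= 2 * c & b <= 2 * d]].
  move=> a0 b0; rewrite !minr_pMr// ge_max !le_min; split.
    by move=> /andP[/andP[/andP[? ?] /andP[? ?]] /andP[/andP[? ?] /andP[? ?]]].
  by case=> ? ? [*]; do !(apply/andP; split); lra.
rewrite max_min ?subr_gt0 ?lo_lt_hi// !hi_sub_lo {max_min}.
(* With [False] as goal, [lra] would look for its carrier in the hypotheses,
   some of which are about [nat]. *)
have absurd : 0 < 0 :> R -> False by rewrite ltxx.
have Y1 : 1 <= 2 ^+ level i :> R by rewrite exprn_ege1// ler1n.
have Y2 : (0 < level i)%N -> 2 <= 2 ^+ level i :> R.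
  by move=> k0; rewrite -[leLHS]expr1 ler_weXn2l// ler1n.
(* The overlap is at most the shorter length, here at most a quarter of the longer one. *)
have [d2|d2] := leqP (level i).+2 (level j).
  have Z4 : 4 * 2 ^+ level i <= 2 ^+ level j :> R.
    have -> : 4 * 2 ^+ level i = 2 ^+ (level i).+2 :> R by rewrite !exprS; lra.
    by rewrite ler_weXn2l// ler1n.
  split; first by rewrite /level in d2; case; lia.
  by case=> *; exfalso; apply: absurd; lra.
have {d2 kl}[d|d] : level j = (level i).+1 \/ level j = level i by lia.
  (* The longer interval is exactly twice the shorter, so only containment reaches half of it. Level
     [level i] has one above it, hence is not the top. *)
  have x1 : overhang (level i) = 1.
    by rewrite /overhang; rewrite /level in d *; do 2 (case: ifP; first lia).
  rewrite /hi /lo x1 /overhang d !exprS.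
  move: Y1 Y2; move: (2 ^+ level i : R) => Y Y1 Y2; rewrite /level in d Y2 *.
  decide_adjacency absurd.
rewrite /hi /lo d /overhang.
(* With overhang 1 the overlap 2 must reach half the length, [2 * Y]. This happens only at level 0,
   whose two vertices are joined by the edge closing the cycle. *)
have {}Y2 : level i = 0%N /\ 2 ^+ level i = 1 :> R \/
    (0 < level i)%N /\ 2 <= 2 ^+ level i :> R.
  by case: (posnP (level i)) => [->|k0]; [left | right; rewrite Y2].
move: Y1 Y2; move: (2 ^+ level i : R) => Y Y1; rewrite /level in d *.
by case=> -[? ?]; decide_adjacency absurd.
Qed.

End Representation.

Theorem proposition4p5 (R : realType) (n : nat) (hn : 3 <= n) :
  max_tolerance_graph_50 R (cycle_graph hn).
Proof.
pose I (i : cycle_graph hn) : set R := `[lo R n i, hi R n i]%classic.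
exists I, (fun i => len (I i) / 2)%R; split=> //.
- by move=> i; exists (lo R n i), (hi R n i); rewrite ltW ?lo_lt_hi.
- move=> i; rewrite /I len_itvcc divr_gt0// lt_max subr_gt0 lo_lt_hi.
  exact: orbT.
- move=> i j ij; rewrite half_overlapP ?lo_lt_hi//=.
  case/orP: (leq_total (level n i) (level n j)) => ij_level.
    exact: half_overlap_edge.
  rewrite cycle_edge_sym maxC (minC (hi R n i - lo R n i)%R).
  rewrite (minC (hi R n i - lo R n j)%R).
  by apply: half_overlap_edge; rewrite // eq_sym.
Qed.
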